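(* Let $M\ge 1$ be real and let $(a_n)_{n\ge1}$ be a sequence of real numbers. (1) The weak projection of the series $\sum_n a_n$ is absolutely convergent in $\mathbf{A}_{-M,M}$, i.e. the sequence $\left(t\left(\sum_{n=1}^k |a_n|\right)\right)_{k\ge1}$ converges in $[-M,M]$. (2) If the series $\sum_n a_n$ is either convergent in $\mathbb{R}$, or divergent to $+\infty$, or divergent to $-\infty$, then its weak projection converges in $\mathbf{A}_{-M,M}$, i.e. the sequence $\left(t\left(\sum_{n=1}^k a_n\right)\right)_{k\ge1}$ converges in $[-M,M]$.
   Context: $\mathbf{A}_{-M,M}$ has underlying set $[-M,M]$ with the topology induced from $\mathbb{R}$. The coprojector $t:\mathbb{R}\to[-M,M]$ is given by $t(a)=a$ if $a\in[-M,M]$, $t(a)=M$ if $a>M$, and $t(a)=-M$ if $a<-M$. The weak projection of a series of real numbers onto $\mathbf{A}_{-M,M}$ is the sequence of images under $t$ of its partial sums; it converges if this sequence has a limit in $[-M,M]$. It is absolutely convergent if the weak projection of the series of absolute values converges. *)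

(* Defs.v *)
From HB Require Import structures.
From mathcomp Require Import all_boot all_order all_algebra.
From mathcomp Require Import all_classical all_reals all_analysis.
Set Implicit Arguments.
Unset Strict Implicit.
Unset Printing Implicit Defensive.
Import Order.TTheory GRing.Theory Num.Theory.
Import numFieldNormedType.Exports.
Local Open Scope classical_set_scope.
Local Open Scope ring_scope.

(* The space A_{-M,M}. As a type, this set is [set_type (sym_itv M)],
   that is {x : R | x \in `[-M, M]}, whose canonical topology is the initial
   topology of the inclusion into R (the induced topology). *)
Definition sym_itv (R : realType) (M : R) : set R := `[- M, M].

Definition coproj_val (R : realType) (M a : R) : R :=
  if - M <= a <= M then a else if M < a then M else - M.

Lemma coproj_valP (R : realType) (M : R) (hM : 1 <= M) (a : R) :
  coproj_val M a \in sym_itv M.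
Proof.
have M0 : 0 <= M by exact: le_trans ler01 hM.
have NMM : - M <= M by rewrite (le_trans _ M0) ?oppr_le0.
rewrite /sym_itv; apply/mem_set; rewrite /= in_itv /= /coproj_val.
by case: ifP => // _; case: ifP => _; rewrite lexx ?NMM.
Qed.

Definition coproj (R : realType) (M : R) (hM : 1 <= M) (a : R) : sym_itv M :=
  SigSub (coproj_valP hM a).

(* Series are indexed from 1: the value [a 0] is never used, and the k-th
   partial sum is a 1 + ... + a k. The term k = 0 (the empty sum) is irrelevant
   to limits along \oo. *)
Definition psum (R : realType) (a : nat -> R) (k : nat) : R :=
  \sum_(1 <= n < k.+1) a n.

Definition weak_proj (R : realType) (M : R) (hM : 1 <= M) (a : nat -> R)
    (k : nat) : sym_itv M :=
  coproj hM (psum a k).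

(* Convergence takes place in the subtype [sym_itv M]. It is stated with an
   explicit limit because [cvgn] requires a pointed type. *)
Definition weak_proj_cvg (R : realType) (M : R) (hM : 1 <= M)
    (a : nat -> R) : Prop :=
  exists l : sym_itv M, weak_proj hM a @ \oo --> l.

Definition weak_proj_abs_cvg (R : realType) (M : R) (hM : 1 <= M)
    (a : nat -> R) : Prop :=
  weak_proj_cvg hM (fun n => `|a n|).

(* Main.v *)
Require Import Defs.
From mathcomp Require Import all_boot all_order all_algebra.
From mathcomp Require Import all_classical all_reals all_analysis.
Import Order.TTheory GRing.Theory Num.Theory.
Import numFieldNormedType.Exports.
Local Open Scope classical_set_scope.
Local Open Scope ring_scope.

(* The coprojector is continuous and constant on each of the rays [M, +oo[ and
   ]-oo, -M], so a limit in [-oo, +oo] of the partial sums yields a limit of the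
   projected sums. Partial sums of absolute values are nondecreasing, hence
   always have such a limit. *)

(** Clamping by [max] and [min] replaces the case split, so that continuity is inherited from these
    operations. *)
Lemma coproj_valE (R : realType) (M : R) (hM : 1 <= M) (a : R) :
  coproj_val M a = Num.max (- M) (Num.min M a).
Proof.
have NMM : - M <= M by rewrite ge0_cp ?(le_trans ler01).
rewrite /coproj_val; case: (ltP M a) => [Ma|aM]; first by rewrite andbF max_r.
rewrite andbT; case: ifPn => [Na|]; first by rewrite max_r.
by rewrite -ltNge => /ltW Na; rewrite max_l.
Qed.

Lemma coproj_continuous (R : realType) (M : R) (hM : 1 <= M) :
  continuous (coproj hM).
Proof.
(* The topology of [sym_itv M] is initial for the inclusion, so it suffices that the real-valued
   composite is continuous. *)
apply: continuous_comp_initial => x /=.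
rewrite (_ : _ \o _ = fun y => Num.max (- M) (Num.min M y)); last first.
  by apply/funext => y /=; exact: coproj_valE.
apply: (@continuous_max R R (cst (- M)) (fun y => Num.min M y)).
  exact: cvg_cst.
by apply: (@continuous_min R R (cst M) id); [exact: cvg_cst|exact: cvg_id].
Qed.

Lemma psum_nondecreasing (R : realType) (a : nat -> R) :
  (forall n, 0 <= a n) -> nondecreasing_seq (psum a).
Proof.
move=> a0; apply/nondecreasing_seqP => n.
by rewrite /psum [leRHS]big_nat_recr //= lerDl.
Qed.

Lemma weak_proj_cvg_or_dvg (R : realType) (M : R) (hM : 1 <= M)
    (a : nat -> R) :
  [\/ cvgn (psum a), psum a @ \oo --> +oo | psum a @ \oo --> -oo] ->
  weak_proj_cvg hM a.
Proof.
have M0 : 0 <= M := le_trans ler01 hM.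
case=> [/cvg_ex[l ul]|/cvgryPge/(_ M) ul|/cvgrNyPle/(_ (- M)) ul].
- exists (coproj hM l).
  exact: (cvg_comp _ _ ul (coproj_continuous _ _ hM l)).
(* The witness is the endpoint [M] as a point of the subtype; the projected sums equal it once the
   partial sums are at least [M]. *)
- exists (coproj hM M); apply: cvg_near_cst; near=> k.
  apply: val_inj => /=; rewrite !(coproj_valE _ _ hM) minxx min_l//.
  by near: k.
- exists (coproj hM (- M)); apply: cvg_near_cst; near=> k.
  apply: val_inj => /=; rewrite !(coproj_valE _ _ hM).
  rewrite (min_r (y := - M)) ?ge0_cp// maxxx.
  by rewrite max_l// ge_min; apply/orP; right; near: k.
Unshelve. all: by end_near. Qed.

Theorem corollary1 (R : realType) (M : R) (hM : 1 <= M) (a : nat -> R) :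
  weak_proj_abs_cvg hM a /\
  ([\/ cvgn (psum a),
       psum a @ \oo --> +oo |
       psum a @ \oo --> -oo] ->
   weak_proj_cvg hM a).
Proof.
split; last exact: weak_proj_cvg_or_dvg.
apply: weak_proj_cvg_or_dvg.
(* By excluded middle: a nondecreasing sequence with no finite limit tends to [+oo]. *)
have [?|dv] := pselect (cvgn (psum (fun n => `|a n|))); first exact: Or31.
by apply: Or32; apply: nondecreasing_dvgn_lt => //; exact: psum_nondecreasing.
Qed.
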